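(* Let $f_1,\dots,f_n\in\mathbf R[x]$, $x=(x_1,\dots,x_n)$, and $\delta_f=\sum_{i=1}^n(\deg(f_i)-1)$. Let $E'$ be a functional on $\mathbf R[x]$ that either annuls $(f)_x$, or annuls $(f)_x^{\le\delta_f+\varepsilon}$ for some integer $\varepsilon\ge0$, and suppose $E'*1-1\in(f)_x$. Then: 1) $\mathbf R[x]/(f)_x$ coincides with the set of all residue classes modulo $(f)_x$ of the polynomials $E'*F$ with $F\in\mathbf R[x^{\le\delta_f}]$. Moreover, $E'*F\in\mathbf R[x^{\le\delta_f}]$ for such $F$. 2) For every integer $d'\ge\delta_f$, the set $(f)_x\cap\mathbf R[x^{\le d'}]$ coincides with the set of all elements of the form $F-E'*F$ with $F\in\mathbf R[x^{\le d'}]$.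
   Context: $\mathbf R$ is a commutative ring with unity, $x=(x_1,\dots,x_n)$ are variables and $y=(y_1,\dots,y_n)$ is a second copy of them. $\deg$ is total degree; the $f_i$ are nonzero so that $\deg f_i$ is an integer. $\mathbf R[x^{\le d}]$ is the set of polynomials in $\mathbf R[x]$ of total degree $\le d$ (it is $\{0\}$ if $d<0$). $(f)_x$ is the ideal of $\mathbf R[x]$ generated by $f_1,\dots,f_n$. $(f)_x^{\le d}$ is the set of all $\sum_i f_i g_i$ with $g_i\in\mathbf R[x^{\le d-\deg f_i}]$. A functional is an $\mathbf R$-linear map $L:\mathbf R[x]\to\mathbf R$, with value on $F$ written $L.F$. It annuls a set $S$ if $L.s=0$ for all $s\in S$. $L(y_* )$ denotes the functional $L$ acting on the variables $y$; it is applied to a polynomial in $(x,y)$ by $\mathbf R[x]$-linear extension and gives an element of $\mathbf R[x]$. Difference derivatives: $\nabla F(x,y)$ is a column $(\nabla^1F,\dots,\nabla^nF)^T$ of polynomials in $\mathbf R[x,y]$ of total degree $\le\deg F-1$ in $(x,y)$ (zero if $F$ is constant) with $F(x)-F(y)=\sum_k(x_k-y_k)\nabla^kF(x,y)$. Fix any choice of $\nabla f_i$ for each $i$, and let $\nabla f(x,y)$ be the $n\times n$ matrix with columns $\nabla f_1,\dots,\nabla f_n$. Also fix an $\mathbf R$-linear operator $\nabla_x(x,y):F\mapsto\nabla F(x,y)$ giving such columns for all $F\in\mathbf R[x]$. Extension operation: for a functional $L$ and $F\in\mathbf R[x]$, $$L*F=L(y_* ).\det\begin{pmatrix}\nabla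 f(x,y)&\nabla F(x,y)\\ f(x)&F(x)\end{pmatrix}=L(y_* ).\det\begin{pmatrix}\nabla f(x,y)&\nabla F(x,y)\\ f(y)&F(y)\end{pmatrix}\in\mathbf R[x],$$ where $f(x)$ is the row $(f_1(x),\dots,f_n(x))$. *)

(* Defs.v *)
From HB Require Import structures.
From mathcomp Require Import all_boot all_order all_algebra.
From mathcomp Require Import classical_sets.
From mathcomp.multinomials Require Import ssrcomplements.
From mathcomp.multinomials Require Export mpoly.

Set Implicit Arguments.
Unset Strict Implicit.
Unset Printing Implicit Defensive.

Import Order.TTheory GRing.Theory Num.Theory.

Local Open Scope classical_set_scope.
Local Open Scope ring_scope.

(* [R[x]] is [{mpoly R[n]}]; [R[x, y]] is [{mpoly R[n + n]}], where [x_k] is the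
   variable of index [lshift n k] and [y_k] the one of index [rshift n k]. *)

Section Degree.
Variables (n : nat) (R : comNzRingType).
Implicit Types (p : {mpoly R[n]}) (d : int).

(* This is the total degree only for [p != 0]; [mdegree 0 = -1] is junk. *)
Definition mdegree p : int := (msize p)%:Z - 1.

(* The degree is an integer: if [d < 0] this is [[set 0]]. *)
Definition polys_le d : set {mpoly R[n]} :=
  [set p | forall m, m \in msupp p -> (mdeg m)%:Z <= d].

End Degree.

Section Ideal.
Variables (n : nat) (R : comNzRingType).
Implicit Types (f : 'I_n -> {mpoly R[n]}) (d : int).

Definition ideal f : set {mpoly R[n]} :=
  [set p | exists g : 'I_n -> {mpoly R[n]}, p = \sum_i f i * g i].

Definition ideal_le f d : set {mpoly R[n]} :=
  [set p | exists g : 'I_n -> {mpoly R[n]},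
     (forall i, polys_le (d - mdegree (f i)) (g i)) /\ p = \sum_i f i * g i].

Definition delta f : int := \sum_i (mdegree (f i) - 1).

(* The elements of [R[x]/(f)_x] are the sets [residue f F]. *)
Definition residue f (F : {mpoly R[n]}) : set {mpoly R[n]} :=
  [set G | ideal f (G - F)].

Definition annuls (L : {scalar {mpoly R[n]}}) (S : set {mpoly R[n]}) : Prop :=
  forall s, S s -> L s = 0.

End Ideal.

Section Extension.
Variables (n : nat) (R : comNzRingType).
Notation Rx := {mpoly R[n]}.
Notation Rxy := {mpoly R[(n + n)%N]}.
Implicit Types (F : Rx) (f : 'I_n -> Rx) (L : {scalar Rx}).

Definition in_x F : Rxy := F \mPo [tuple 'X_(lshift n i) | i < n].
Definition in_y F : Rxy := F \mPo [tuple 'X_(rshift n i) | i < n].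

Definition xpart (m : 'X_{1..(n + n)%N}) : 'X_{1..n} :=
  [multinom m (lshift n i) | i < n].
Definition ypart (m : 'X_{1..(n + n)%N}) : 'X_{1..n} :=
  [multinom m (rshift n i) | i < n].

(* [L(y_* )]: the [R[x]]-linear extension of [y^b |-> L.x^b], see
   [apply_yM]. *)
Definition apply_y L (P : Rxy) : Rx :=
  \sum_(m <- msupp P) (P@_m * L 'X_[ypart m]) *: 'X_[xpart m].

Lemma apply_yE L k (P : Rxy) : (msize P <= k)%N ->
  apply_y L P = \sum_(m : 'X_{1..(n + n)%N < k})
    (P@_m * L 'X_[ypart m]) *: 'X_[xpart m].
Proof.
move=> le_Pk; pose I : subFinType _ := 'X_{1..(n + n)%N < k}.
rewrite /apply_y (big_mksub I) //=; first last.
- by move=> m /msize_mdeg_lt /leq_trans; apply.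
- by rewrite msupp_uniq.
rewrite big_rmcond //= => m /memN_msupp_eq0 ->.
by rewrite mul0r scale0r.
Qed.

Lemma apply_y_is_linear L : linear (apply_y L).
Proof.
move=> c P Q; pose k := maxn (msize (c *: P + Q)) (maxn (msize P) (msize Q)).
rewrite !(@apply_yE _ k) ?leq_max ?leqnn ?orbT // scaler_sumr -big_split /=.
apply: eq_bigr => m _.
by rewrite mcoeffD mcoeffZ mulrDl scalerDl -mulrA scalerA.
Qed.

HB.instance Definition _ L :=
  GRing.isLinear.Build R Rxy Rx *:%R (apply_y L) (apply_y_is_linear L).

Lemma apply_yZ L c P : apply_y L (c *: P) = c *: apply_y L P.
Proof. exact: linearZZ. Qed.

Lemma apply_yX L m : apply_y L 'X_[m] = L 'X_[ypart m] *: 'X_[xpart m].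
Proof. by rewrite /apply_y msuppX big_seq1 mcoeffX eqxx mul1r. Qed.

Lemma in_x_in_yX (a b : 'X_{1..n}) :
  in_x 'X_[a] * in_y 'X_[b] =
  'X_[[multinom match split i with inl j => a j | inr j => b j end
      | i < (n + n)%N]].
Proof.
rewrite /in_x /in_y !comp_mpolyX !mpolyXE_id big_split_ord /=.
by congr (_ * _); apply: eq_bigr => i _;
  rewrite tnth_mktuple mnmE ?(unsplitK (inl _)) ?(unsplitK (inr _)).
Qed.

Lemma apply_yM L A B : apply_y L (in_x A * in_y B) = L B *: A.
Proof.
have X a b : apply_y L (in_x 'X_[a] * in_y 'X_[b]) = L 'X_[b] *: 'X_[a].
  rewrite in_x_in_yX apply_yX; congr (L 'X_[_] *: 'X_[_]); apply/mnmP => i.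
    by rewrite !mnmE (unsplitK (inr _)).
  by rewrite !mnmE (unsplitK (inl _)).
have Y a : apply_y L (in_x 'X_[a] * in_y B) = L B *: 'X_[a].
  rewrite [B]mpolyE /in_y !raddf_sum /= mulr_sumr raddf_sum scaler_suml.
  apply: eq_bigr => b _; rewrite comp_mpolyZ -scalerAr /= apply_yZ linearZ.
  rewrite -/(in_y 'X_[b]) X.
  by rewrite scalerA.
rewrite [in LHS](mpolyE A) [in RHS](mpolyE A) /in_x raddf_sum /=.
rewrite mulr_suml raddf_sum scaler_sumr.
apply: eq_bigr => a _; rewrite comp_mpolyZ -scalerAl /= apply_yZ -/(in_x 'X_[a]) Y.
by rewrite !scalerA mulrC.
Qed.

(* The degree bound is negative when [F] is constant (or 0), so that [v] is
   then 0. *)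
Definition is_nabla F (v : 'cV[Rxy]_n) : Prop :=
  (forall k, polys_le (mdegree F - 1) (v k 0)) /\
  in_x F - in_y F = \sum_k ('X_(lshift n k) - 'X_(rshift n k)) * v k 0.

(* The columns of [nf] are the [nabla f_i], the column [v] is [nabla F]. *)
Definition extend_det (at_ : Rx -> Rxy) f (nf : 'M[Rxy]_n) F (v : 'cV[Rxy]_n)
    : Rxy :=
  \det (block_mx nf                    v
                 (\row_i at_ (f i))    (at_ F)%:M).

Lemma extend_detE f (nf : 'M[Rxy]_n) F (v : 'cV[Rxy]_n) :
  (forall i, is_nabla (f i) (col i nf)) -> is_nabla F v ->
  extend_det in_x f nf F v = extend_det in_y f nf F v.
Proof.
move=> nfP [_ Fv]; pose d : 'rV[Rxy]_n :=
  \row_k ('X_(lshift n k) - 'X_(rshift n k)).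
rewrite /extend_det; set Mx := block_mx _ _ _ _; set My := block_mx _ _ _ _.
suff -> : Mx = block_mx 1%:M 0 d 1%:M *m My.
  by rewrite det_mulmx det_lblock !det1 !mul1r.
rewrite mulmx_block !mul1mx !mul0mx !addr0; congr block_mx.
  apply/rowP => i; rewrite !mxE; have [_ /eqP] := nfP i.
  rewrite subr_eq => /eqP ->; congr (_ + _).
  by apply: eq_bigr => k _; rewrite !mxE.
apply/matrixP => i j; rewrite !ord1 !mxE !mulr1n.
move/eqP: Fv; rewrite subr_eq => /eqP ->; congr (_ + _).
by apply: eq_bigr => k _; rewrite !mxE.
Qed.

(* [L * F], with [nabla k F] the [k]-th entry of the operator [nabla_x(x, y)].
   By [extend_detE], [in_y] may replace [in_x]. *)
Definition extend f (nf : 'M[Rxy]_n)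
    (nabla : 'I_n -> {linear Rx -> Rxy}) L F : Rx :=
  apply_y L (extend_det in_x f nf F (\col_k nabla k F)).

End Extension.

(* Main.v *)
Require Import Defs.
From mathcomp Require Import all_boot all_order all_algebra.
From mathcomp Require Import classical_sets perm zify ring.

Import Order.TTheory GRing.Theory Num.Theory.
Local Open Scope classical_set_scope.
Local Open Scope ring_scope.

Set Implicit Arguments.
Unset Strict Implicit.
Unset Printing Implicit Defensive.

(** Write M for the matrix of the difference derivatives of the f_i, B for its
    determinant, and T for the operator F |-> E' * F.

    The formula for a bordered determinant ([det_border]) gives
      T F = E'(y).(F(x) B - f(x) adj(M) nabla F)
          = E'(y).(F(y) B - f(y) adj(M) nabla F).
    By the first expression T F is F (T 1) modulo the ideal, hence T F = F
    modulo the ideal ([extend_sub_ideal]).  The second one bounds degrees.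
    Either hypothesis on E' implies that E' annuls the elements f_i h of the
    ideal with deg h <= delta - deg f_i.  In a polynomial f_i(y) p(x, y) with
    deg p <= D - deg f_i, a monomial x^a y^b of p can therefore survive E'(y)
    only if |a| < D - delta ([polys_le_apply_y_annuls]).  Since the entries of
    adj(M) nabla F are determinants of M with one column replaced by nabla F,
    this yields deg T F <= max(delta, deg F - 1) ([extend_degree]).  Iterating T
    brings any F down to degree delta inside its residue class, which is the
    first claim.

    The second claim asks to solve F - T F = G for G in the ideal.  As E' does
    not annul the whole ideal, T G need not be 0, but T is nilpotent on the
    ideal: if G = sum_j f_j g_j with all deg (f_j g_j) <= N, then T G has such
    an expression with N - 1 ([extend_ideal_le]), and there is none but 0 when
    N < 0.  So F = G + T G + T (T G) + ... is a finite sum and a solution.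

    To lower N, compare nabla G with the column
    sum_j (g_j(y) nabla f_j + f_j(x) nabla g_j) given by the product rule.
    Their difference w satisfies sum_k (x_k - y_k) w_k = 0, and the relation
    (x - y) M = f(x) - f(y) turns the determinant of T G into
    - f(y) adj(M) (sum_j f_j(x) nabla g_j) - f(x) adj(M) w
    ([product_rule_det]).  The first term is a combination of the products
    f_i(y) f_j(x).  So is the second one: w is a combination, with controlled
    degrees, of the Koszul syzygies (x_k - y_k) e_l - (x_l - y_l) e_k
    ([koszul_ind]), and for these Cramer's rule produces alternating
    coefficients, which cancel the products f_i(x) f_j(x) ([adjM_syzygy]).
    Applying E'(y) to the factor of f_j(x) lowers its degree as above. *)

(** * Degree bounds *)

Section DegreeBounds.
Variables (n : nat) (R : comNzRingType).
Implicit Types (p q : {mpoly R[n]}) (d e : int) (m : 'X_{1..n}).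

Lemma polys_leP d p :
  polys_le d p <-> forall m, d < (mdeg m)%:Z -> p@_m = 0.
Proof.
split=> [pd m dm|pd m].
  apply/eqP; rewrite mcoeff_eq0; apply/negP => /pd.
  by rewrite leNgt dm.
by rewrite mcoeff_msupp leNgt; apply: contra => /pd ->.
Qed.

Lemma polys_leW d e p : d <= e -> polys_le d p -> polys_le e p.
Proof. by move=> de pd m /pd /le_trans; apply. Qed.

Lemma polys_le0 d : polys_le d (0 : {mpoly R[n]}).
Proof. by move=> m; rewrite msupp0. Qed.

Lemma polys_leD d p q : polys_le d p -> polys_le d q -> polys_le d (p + q).
Proof.
move=> /polys_leP pd /polys_leP qd; apply/polys_leP => m dm.
by rewrite mcoeffD pd ?qd ?addr0.
Qed.

Lemma polys_leZ d c p : polys_le d p -> polys_le d (c *: p).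
Proof.
move=> /polys_leP pd; apply/polys_leP => m dm.
by rewrite mcoeffZ pd ?mulr0.
Qed.

Lemma polys_leN d p : polys_le d p -> polys_le d (- p).
Proof. by rewrite -scaleN1r; apply: polys_leZ. Qed.

Lemma polys_leB d p q : polys_le d p -> polys_le d q -> polys_le d (p - q).
Proof. by move=> pd qd; apply/polys_leD/polys_leN. Qed.

Lemma polys_le_sum (I : Type) (r : seq I) (P : pred I) d F :
  (forall i, P i -> polys_le d (F i)) ->
  polys_le d (\sum_(i <- r | P i) F i : {mpoly R[n]}).
Proof.
by move=> Fd; apply: big_ind => //; [apply: polys_le0 | apply: polys_leD].
Qed.

Lemma polys_leX d m : (mdeg m)%:Z <= d -> polys_le d ('X_[m] : {mpoly R[n]}).
Proof. by move=> md m'; rewrite msuppX inE => /eqP ->. Qed.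

Lemma polys_le_lt0 d p : d < 0 -> polys_le d p -> p = 0.
Proof.
move=> d0 /polys_leP pd; apply/mpolyP => m.
by rewrite mcoeff0 pd // (lt_le_trans d0).
Qed.

Lemma polys_le_ind (P : {mpoly R[n]} -> Prop) d :
  P 0 -> (forall p q, P p -> P q -> P (p + q)) ->
  (forall c m, (mdeg m)%:Z <= d -> P (c *: 'X_[m])) ->
  forall p, polys_le d p -> P p.
Proof.
move=> P0 PD PX p pd; rewrite (mpolyE p) big_seq.
by apply: big_ind => // m /pd; apply: PX.
Qed.

Lemma polys_leM d e p q :
  polys_le d p -> polys_le e q -> polys_le (d + e) (p * q).
Proof.
move=> pd qe m /msuppM_le /allpairsP[[a b] /= [/pd ad /qe be ->]].
by rewrite mdegD PoszD lerD.
Qed.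

Lemma polys_le1 d : 0 <= d -> polys_le d (1 : {mpoly R[n]}).
Proof. by move=> d0; rewrite -mpolyX0; apply: polys_leX; rewrite mdeg0. Qed.

Lemma polys_le_prod (I : Type) (r : seq I) (P : pred I) (d : I -> int) F :
  (forall i, P i -> polys_le (d i) (F i)) ->
  polys_le (\sum_(i <- r | P i) d i) (\prod_(i <- r | P i) F i : {mpoly R[n]}).
Proof.
move=> Fd; elim/big_rec2: _ => [|i d' p Pi pd']; first exact: polys_le1.
by apply: polys_leM => //; apply: Fd.
Qed.

Lemma polys_le_exp d p k : polys_le d p -> polys_le (d *+ k) (p ^+ k).
Proof.
move=> pd; elim: k => [|k IH]; first exact: polys_le1.
by rewrite mulrS exprS; apply: polys_leM.
Qed.

Lemma polys_le_det k (A : 'M[{mpoly R[n]}]_k) (d : 'I_k -> int) :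
  (forall i j, polys_le (d j) (A i j)) -> polys_le (\sum_j d j) (\det A).
Proof.
move=> Ad; apply: polys_le_sum => s _; rewrite -signr_odd.
have -> : \sum_j d j = \sum_i d (s i) by rewrite (reindex_perm s).
have : polys_le (\sum_i d (s i)) (\prod_i A i (s i)) by apply: polys_le_prod.
by case: (odd s) => [/polys_leN|]; rewrite ?mul1r // expr1 mulN1r.
Qed.

Lemma mdegree_ge0 p : p != 0 -> 0 <= mdegree p.
Proof. by rewrite -msize_poly_eq0 /mdegree; case: (msize p) => //; lia. Qed.

Lemma polys_le_mdegree p : polys_le (mdegree p) p.
Proof.
by move=> m /msize_mdeg_lt; rewrite /mdegree; case: (msize p) => // k; lia.
Qed.

Lemma mdegree_le d p : p != 0 -> polys_le d p -> mdegree p <= d.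
Proof.
move=> p0 /(_ (mlead p)); rewrite mlead_supp // => /(_ isT).
by rewrite /mdegree -mlead_deg //; lia.
Qed.

Lemma polys_leU (i : 'I_n) : polys_le 1 ('X_i : {mpoly R[n]}).
Proof. by apply: polys_leX; rewrite mdeg1. Qed.

End DegreeBounds.

Lemma polys_le_comp n k (R : comNzRingType) (t : n.-tuple {mpoly R[k]}) d
    (p : {mpoly R[n]}) :
  (forall i, polys_le 1 (tnth t i)) -> polys_le d p -> polys_le d (p \mPo t).
Proof.
move=> t1.
apply: (polys_le_ind (P := fun p => polys_le d (p \mPo t)))
  => [|p1 p2 p1d p2d|c m md].
- by rewrite /= comp_mpoly0; apply: polys_le0.
- by rewrite comp_mpolyD; apply: polys_leD.
rewrite comp_mpolyZ comp_mpolyX; apply/polys_leZ/(polys_leW md).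
rewrite mdegE -[X in polys_le X]natz natr_sum.
by apply: polys_le_prod => i _; apply: polys_le_exp.
Qed.

(** * Bordered determinants and Cramer's rule *)

Section Determinants.
Variables (S : comNzRingType) (n : nat).
Implicit Types (A : 'M[S]_n) (v w : 'cV[S]_n) (i j : 'I_n).

Definition repl_col A i w : 'M[S]_n :=
  \matrix_(k, j) if j == i then w k 0 else A k j.

Lemma mul_adj_colE A w i : (\adj A *m w) i 0 = \det (repl_col A i w).
Proof.
rewrite mxE (expand_det_col _ i); apply: eq_bigr => k _.
rewrite !mxE eqxx mulrC; congr (_ * (_ * \det _)).
by apply/matrixP => a b; rewrite !mxE eq_sym (negPf (neq_lift _ _)).
Qed.

Lemma repl_col_swap A i j v w : i != j ->
  \det (repl_col (repl_col A i v) j w) = - \det (repl_col (repl_col A j v) i w).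
Proof.
move=> ij; rewrite -[LHS]det_tr -[in RHS]det_tr.
have -> : (repl_col (repl_col A i v) j w)^T =
    row_perm (tperm i j) (repl_col (repl_col A j v) i w)^T.
  apply/matrixP => a b; rewrite !mxE.
  case: tpermP => [->|->|]; rewrite ?eqxx ?(negPf ij) //.
    by rewrite eq_sym (negPf ij).
  by move=> /eqP/negPf -> /eqP/negPf ->.
by rewrite row_permE det_mulmx det_perm odd_tperm ij expr1 mulN1r.
Qed.

(** This is u N (adj(N) v) = (u v) det N, where N is A with its i-th column
    replaced by w.  The entries of adj(N) v are determinants of N with a column
    replaced by v; the i-th of them does not involve w any more, and its term is
    moved to the left-hand side. *)
Lemma repl_col_cross A (u : 'rV[S]_n) v w i :
  (u *m v) 0 0 * \det (repl_col A i w) - (u *m w) 0 0 * \det (repl_col A i v) =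
  \sum_(j | j != i) (u *m A) 0 j * \det (repl_col (repl_col A i w) j v).
Proof.
set N := repl_col A i w.
have : (u *m N *m (\adj N *m v)) 0 0 = (u *m v) 0 0 * \det N.
  by rewrite mulmxA -(mulmxA u) mul_mx_adj mul_mx_scalar -scalemxAl mxE mulrC.
rewrite mxE (bigD1 i) //= mul_adj_colE => <-.
have -> : repl_col N i v = repl_col A i v.
  by apply/matrixP => a b; rewrite !mxE; case: eqP.
have -> : (u *m N) 0 i = (u *m w) 0 0.
  by rewrite !mxE; apply: eq_bigr => k _; rewrite mxE eqxx.
rewrite addrAC subrr add0r; apply: eq_bigr => j ji.
rewrite mul_adj_colE; congr (_ * _).
by rewrite !mxE; apply: eq_bigr => k _; rewrite mxE (negPf ji).
Qed.

(** If det A were regular, multiplying the bordered matrix by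
    [1, - adj(A) v; 0, det A] would make it block triangular and prove the
    formula.  Over an arbitrary ring this is done for X + A in place of A, whose
    determinant is monic in X, and X is then specialized to 0. *)
Lemma det_border A v (r : 'rV[S]_n) (s : S) :
  \det (block_mx A v r s%:M) = s * \det A - (r *m (\adj A *m v)) 0 0.
Proof.
pose pA : 'M[{poly S}]_n := 'X%:M + map_mx polyC A.
pose pv := map_mx polyC v; pose pr := map_mx polyC r.
have reg : GRing.lreg (\det pA).
  apply: monic_lreg; have -> : pA = char_poly_mx (- A).
    by rewrite /char_poly_mx map_mxN opprK.
  exact: char_poly_monic.
pose h : {rmorphism {poly S} -> S} := horner_eval (0 : S).
have hA : map_mx h pA = A.
  apply/matrixP => i j; rewrite !mxE /h /= /horner_eval.
  by rewrite hornerD hornerMn hornerX hornerC mul0rn add0r.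
have hC p q (B : 'M[S]_(p, q)) : map_mx h (map_mx polyC B) = B.
  by apply/matrixP => i j; rewrite !mxE /h /= /horner_eval hornerC.
suff H : \det (block_mx pA pv pr s%:P%:M) =
    s%:P * \det pA - (pr *m (\adj pA *m pv)) 0 0.
  have := congr1 h H; rewrite rmorphB rmorphM -!det_map_mx.
  rewrite map_block_mx hA !hC map_scalar_mx.
  have -> : h (s%:P) = s by rewrite /h /= /horner_eval hornerC.
  move=> ->; congr (_ - _).
  have -> (C : 'M[{poly S}]_1) : h (C 0 0) = (map_mx h C) 0 0 by rewrite mxE.
  by rewrite !map_mxM /= map_mx_adj hA !hC.
apply: reg; rewrite mulrC.
have -> : \det (block_mx pA pv pr s%:P%:M) * \det pA =
   \det (block_mx pA pv pr s%:P%:M *m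
     block_mx 1%:M (- (\adj pA *m pv)) 0 (\det pA)%:M).
  by rewrite det_mulmx det_ublock det1 mul1r det_scalar1.
rewrite mulmx_block !mulmx1 !mulmx0 !addr0 mulmxN mulmxA mul_mx_adj.
rewrite mul_scalar_mx mul_mx_scalar addNr det_lblock; congr (_ * _).
rewrite det_mx11.
rewrite mulmxN -scalar_mxM mxE [X in X + _]mxE [X in _ + X]mxE.
by rewrite eqxx mulr1n addrC.
Qed.

Lemma mul_adj_shift A (u a b : 'rV[S]_n) v : a = b + u *m A ->
  (a *m (\adj A *m v)) 0 0 = (b *m (\adj A *m v)) 0 0 + \det A * (u *m v) 0 0.
Proof.
move=> ->; rewrite mulmxDl mxE; congr (_ + _).
by rewrite -mulmxA [A *m _]mulmxA mul_mx_adj mul_scalar_mx -scalemxAr mxE.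
Qed.

(** Here a, b, c, d stand for the rows f(x), f(y), g(x), g(y), the columns of A
    and V are the difference derivatives of the f_j and g_j, and v is that of
    sum_j f_j g_j.  The column w measures the failure of the product rule. *)
Section ProductRule.
Variables (A V : 'M[S]_n) (u a b c d : 'rV[S]_n) (v : 'cV[S]_n).
Hypotheses (aE : a = b + u *m A) (uV : u *m V = c - d).
Hypothesis uv : (u *m v) 0 0 = (a *m c^T) 0 0 - (b *m d^T) 0 0.
Let w := v - A *m d^T - V *m a^T.

Let dotC (p q : 'rV[S]_n) : (p *m q^T) 0 0 = (q *m p^T) 0 0.
Proof. by rewrite !mxE; apply: eq_bigr => i _; rewrite !mxE mulrC. Qed.

Lemma product_rule_syzygy : u *m w = 0.
Proof.
apply/matrixP => i j; rewrite !ord1 [RHS]mxE !mulmxBr !mulmxA uV.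
have -> : u *m A = a - b by rewrite aE addrAC subrr add0r.
have entry3 (X Y Z : 'M[S]_1) : (X - Y - Z) 0 0 = X 0 0 - Y 0 0 - Z 0 0.
  by rewrite !mxE.
have entry2 (X Y : 'M[S]_1) : (X - Y) 0 0 = X 0 0 - Y 0 0 by rewrite !mxE.
rewrite !mulmxBl entry3 !entry2 uv (dotC c) (dotC d); ring.
Qed.

(** The contribution of A d^T to a adj(A) v is (det A) a d^T.  That of V a^T is,
    by [mul_adj_shift], b adj(A) V a^T + (det A) (c - d) a^T.  Together they
    cancel (det A) a c^T. *)
Lemma product_rule_det :
  (a *m c^T) 0 0 * \det A - (a *m (\adj A *m v)) 0 0 =
  - ((b *m (\adj A *m (V *m a^T))) 0 0 + (a *m (\adj A *m w)) 0 0).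
Proof.
have entry2 (X Y : 'M[S]_1) : (X - Y) 0 0 = X 0 0 - Y 0 0 by rewrite !mxE.
have entry3 (X Y Z : 'M[S]_1) : (X + Y + Z) 0 0 = X 0 0 + Y 0 0 + Z 0 0.
  by rewrite !mxE.
have -> : v = w + V *m a^T + A *m d^T by rewrite /w !subrK.
rewrite !mulmxDr entry3 (mul_adj_shift (V *m a^T) aE) (mulmxA u) uV.
rewrite (mulmxA (\adj A) A) mul_adj_mx mul_scalar_mx -scalemxAr.
rewrite mulmxBl entry2 [X in _ - (_ + X)]mxE (dotC c) (dotC d).
move: (\det A) ((a *m c^T) 0 0) ((a *m d^T) 0 0) => D p q.
ring.
Qed.

End ProductRule.

End Determinants.

(** * Syzygies of the differences x_k - y_k *)

Section Koszul.
Variable R : comNzRingType.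

(** The leading coefficient is 1 or -1, whichever of the two variables is the
    larger one. *)
Lemma lreg_XB N (i j : 'I_N) :
  i != j -> GRing.lreg ('X_i - 'X_j : {mpoly R[N]}).
Proof.
have lt_reg a b :
    (U_(a)%MM < U_(b)%MM)%O -> GRing.lreg ('X_b - 'X_a : {mpoly R[N]}).
  move=> ab; apply: lreg_mleadc.
  rewrite mleadDl ?mleadN !mleadXm // mcoeffB !mcoeffX eqxx (lt_eqF ab) subr0.
  exact: lreg1.
move=> ij; have := eq_mnm1 i j; rewrite (negPf ij) => /negbT.
rewrite neq_lt => /orP[] /lt_reg //.
by move=> /lregN; rewrite opprB.
Qed.

Section RenameVars.
Variables (N : nat) (s : 'I_N -> 'I_N).

Definition rename_vars (p : {mpoly R[N]}) : {mpoly R[N]} :=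
  p \mPo [tuple 'X_(s i) | i < N].

Lemma rename_varsU i : rename_vars 'X_i = 'X_(s i).
Proof. by rewrite /rename_vars comp_mpolyXU -tnth_nth tnth_mktuple. Qed.

(** Telescoping: renaming the variables of a monomial one occurrence at a time
    changes it by multiples of the X_i - X_(s i). *)
Lemma rename_vars_diff d p : polys_le d p ->
  exists c : 'I_N -> {mpoly R[N]}, (forall i, polys_le (d - 1) (c i)) /\
    p - rename_vars p = \sum_i ('X_i - 'X_(s i)) * c i.
Proof.
apply: (polys_le_ind (P := fun p => exists c : 'I_N -> {mpoly R[N]}, _)).
- exists (fun=> 0); split=> [i|]; first exact: polys_le0.
  by rewrite /rename_vars comp_mpoly0 subrr big1 // => i _; rewrite mulr0.
- move=> {}p q [a [ad pE]] [b [bd qE]]; exists (fun i => a i + b i).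
  split=> [i|]; first exact: polys_leD.
  rewrite /rename_vars comp_mpolyD -/(rename_vars p) -/(rename_vars q).
  rewrite opprD addrACA pE qE.
  by rewrite -big_split; apply: eq_bigr => i _; rewrite mulrDr.
move=> a m md.
suff [c [cm XE]] : exists c : 'I_N -> {mpoly R[N]},
    (forall i, polys_le ((mdeg m)%:Z - 1) (c i)) /\
    'X_[m] - rename_vars 'X_[m] = \sum_i ('X_i - 'X_(s i)) * c i.
  exists (fun i => a *: c i); split=> [i|].
    by apply/polys_leZ/(polys_leW _ (cm i)); rewrite lerB.
  rewrite /rename_vars comp_mpolyZ -/(rename_vars _) -scalerBr XE scaler_sumr.
  by apply: eq_bigr => i _; rewrite scalerAr.
elim: {m md}(mdeg m) {-2}m (erefl (mdeg m)) => [|k IH] m mE.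
  move/eqP: (mE); rewrite mdeg_eq0 => /eqP ->; exists (fun=> 0).
  split=> [i|]; first exact: polys_le0.
  rewrite /rename_vars mpolyX0 comp_mpoly1 subrr big1 // => i _.
  by rewrite mulr0.
have [j mj] : exists j, (0 < m j)%N.
  case: (pickP (fun j => 0 < m j)%N) => [j mj|m0]; first by exists j.
  suff m0' : m = 0%MM by move: mE; rewrite m0' mdeg0.
  by apply/mnmP => i; rewrite mnm0E; case: (m i) (m0 i).
have {mj} mj : (U_(j) + (m - U_(j)))%MM = m.
  by rewrite addmC submK // lep1mP -lt0n.
set m' := (m - U_(j))%MM in mj.
have m'E : mdeg m' = k by move: mE; rewrite -mj mdegD mdeg1 add1n => -[].
have [c [cm XE]] := IH m' m'E.
exists (fun i => 'X_j * c i + (if i == j then rename_vars 'X_[m'] else 0)).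
split=> [i|].
  apply: polys_leD.
    by apply: (polys_leW _ (polys_leM (@polys_leU _ R j) (cm i))); lia.
  case: eqP => _; last exact: polys_le0.
  apply: polys_le_comp => [i'|].
    by rewrite tnth_mktuple; apply: polys_leU.
  by apply: polys_leX; rewrite m'E; lia.
under eq_bigr do rewrite mulrDr.
rewrite big_split /= [X in _ = _ + X](bigD1 j) //= eqxx.
rewrite [X in _ = _ + (_ + X)]big1; last first.
  by move=> i /negPf ->; rewrite mulr0.
under eq_bigr do rewrite mulrCA.
rewrite -mulr_sumr -XE addr0 -mj mpolyXD.
have -> : rename_vars ('X_j * 'X_[m']) = 'X_(s j) * rename_vars 'X_[m'].
  by rewrite -rename_varsU /rename_vars rmorphM.
ring.
Qed.

End RenameVars.

Variable n : nat.
Notation Rxy := {mpoly R[(n + n)%N]}.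

Definition xBy : 'rV[Rxy]_n := \row_k ('X_(lshift n k) - 'X_(rshift n k)).

Definition koszul (k l : 'I_n) : 'cV[Rxy]_n :=
  xBy 0 k *: delta_mx l 0 - xBy 0 l *: delta_mx k 0.

Lemma mul_koszul k l : xBy *m koszul k l = 0.
Proof.
rewrite mulmxBr -!scalemxAr -!colE; apply/matrixP => i j.
by rewrite !ord1 !mxE mulrC subrr.
Qed.

Lemma polys_le_koszul k l i : polys_le 1 (koszul k l i 0).
Proof.
rewrite !mxE !eqxx !andbT.
apply: polys_leB; rewrite mulr_natr; case: eqP => _; rewrite ?mulr0n ?mulr1n.
all: by [apply: polys_le0 | apply: polys_leB; apply: polys_leU].
Qed.

(** Exactness of the Koszul complex of the x_k - y_k in degree one, with degree
    bounds, as an induction principle.  By induction on m, syzygies with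
    w_k = 0 for k >= m are handled.  If l is the last index allowed, setting
    x_k := y_k for k < l in the syzygy leaves (x_l - y_l) w_l = 0, so w_l
    vanishes under this renaming and is a combination of the x_k - y_k with
    k < l; subtracting the corresponding Koszul syzygies kills w_l. *)
Lemma koszul_ind (Q : 'cV[Rxy]_n -> Prop) d :
  Q 0 -> (forall v w, Q v -> Q w -> Q (v + w)) ->
  (forall c k l, polys_le (d - 1) c -> Q (c *: koszul k l)) ->
  forall w : 'cV_n, (forall k, polys_le d (w k 0)) -> xBy *m w = 0 -> Q w.
Proof.
move=> Q0 QD Qk w.
suff H m : (m <= n)%N -> forall w : 'cV_n,
    (forall k : 'I_n, (m <= k)%N -> w k 0 = 0) ->
    (forall k, polys_le d (w k 0)) -> xBy *m w = 0 -> Q w.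
  by apply: (H n) => // k; rewrite leqNgt ltn_ord.
elim: m {w} => [|m IH] mn w w0 wd uw.
  by rewrite (_ : w = 0) //; apply/colP => k; rewrite w0 ?mxE.
pose l := Ordinal mn.
pose s (i : 'I_(n + n)) : 'I_(n + n) :=
  if split i is inl k then (if (k < m)%N then rshift n k else i) else i.
have sl (k : 'I_n) :
    s (lshift n k) = if (k < m)%N then rshift n k else lshift n k.
  by rewrite /s (unsplitK (inl k)).
have sr k : s (rshift n k) = rshift n k by rewrite /s (unsplitK (inr k)).
have s_u (k : 'I_n) :
    rename_vars s (xBy 0 k) = if (k < m)%N then 0 else xBy 0 k.
  rewrite mxE /rename_vars comp_mpolyB -!/(rename_vars _ _) !rename_varsU sl sr.
  by case: ifP; rewrite ?subrr.
have s_w : rename_vars s (w l 0) = 0.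
  have := congr1 (fun A : 'M_1 => rename_vars s (A 0 0)) uw.
  rewrite /rename_vars !mxE comp_mpoly0 raddf_sum (bigD1 l) //= big1 ?addr0.
    rewrite rmorphM /= -!/(rename_vars _ _) s_u ltnn mxE => /eqP.
    by rewrite mulrI_eq0 => [/eqP|]; last by apply: lreg_XB; rewrite eq_lrshift.
  move=> k kl; rewrite rmorphM /= -/(rename_vars _ _) s_u.
  case: ltnP => mk; first by rewrite mul0r.
  rewrite (w0 k) ?rmorph0 ?mulr0 //.
  by rewrite ltn_neqAle mk andbT eq_sym.
have [c [cd]] := rename_vars_diff s (wd l).
rewrite s_w subr0 big_split_ord /= [X in _ + X]big1 ?addr0; last first.
  by move=> k _; rewrite sr subrr mul0r.
move=> wl.
pose v := \sum_(k < n | (k < m)%N) c (lshift n k) *: koszul k l.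
have vE i : v i 0 = \sum_(k < n | (k < m)%N) c (lshift n k) * koszul k l i 0.
  by rewrite summxE; apply: eq_bigr => k _; rewrite mxE.
have Qv : Q v by apply: big_ind => // k _; apply: Qk.
rewrite -(subrK v w); apply: QD => //; apply: IH => //.
- exact: ltnW.
- move=> k mk; rewrite mxE [X in _ + X]mxE vE.
  move: mk; rewrite leq_eqVlt => /predU1P[mk|mk].
    have -> : k = l by apply: val_inj.
    apply/eqP; rewrite subr_eq0 wl big_mkcond /= eq_sym big_mkcond /=.
    apply/eqP/eq_bigr => i _; rewrite sl; case: ltnP => im.
      have /negPf li : l != i by rewrite -val_eqE /= neq_ltn im orbT.
      by rewrite /koszul !mxE !eqxx /= mulr1 li mulr0 subr0 mulrC.
    by rewrite subrr mul0r.
  rewrite w0 // big1 ?subr0 // => i im; rewrite /koszul !mxE.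
  have /negPf -> : k != l by rewrite -val_eqE /= neq_ltn mk orbT.
  have /negPf -> : k != i by rewrite -val_eqE /= neq_ltn (ltn_trans im mk) orbT.
  by rewrite /= !mulr0 subr0 mulr0.
- move=> k; rewrite mxE [X in polys_le _ (_ + X)]mxE vE; apply: polys_leB => //.
  by apply: polys_le_sum => i _; rewrite -(subrK 1 d); apply: polys_leM => //;
  apply: polys_le_koszul.
rewrite mulmxBr uw sub0r mulmx_sumr big1 ?oppr0 // => k _.
by rewrite -scalemxAr mul_koszul scaler0.
Qed.

End Koszul.

(** * Functionals applied to the variables y *)

Section ApplyY.
Variables (n : nat) (R : comNzRingType).
Notation Rx := {mpoly R[n]}.
Notation Rxy := {mpoly R[(n + n)%N]}.
Implicit Types (L : {scalar Rx}) (F G : Rx) (P : Rxy) (d e : int).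

Lemma in_xM F G : in_x (F * G) = in_x F * in_x G.
Proof. exact: rmorphM. Qed.

Lemma in_yM F G : in_y (F * G) = in_y F * in_y G.
Proof. exact: rmorphM. Qed.

Lemma in_x_sum (I : Type) (r : seq I) (H : I -> Rx) :
  in_x (\sum_(i <- r) H i) = \sum_(i <- r) in_x (H i).
Proof. exact: raddf_sum. Qed.

Lemma in_y_sum (I : Type) (r : seq I) (H : I -> Rx) :
  in_y (\sum_(i <- r) H i) = \sum_(i <- r) in_y (H i).
Proof. exact: raddf_sum. Qed.

Lemma monomial_xy (m : 'X_{1..(n + n)%N}) :
  'X_[m] = in_x 'X_[xpart m] * in_y 'X_[ypart m] :> Rxy.
Proof.
rewrite in_x_in_yX; congr 'X_[_]; apply/mnmP => i; rewrite mnmE.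
by rewrite -{1}(splitK i); case: (split i) => j; rewrite mnmE.
Qed.

Lemma mdeg_xy (m : 'X_{1..(n + n)%N}) :
  mdeg m = (mdeg (xpart m) + mdeg (ypart m))%N.
Proof.
rewrite !mdegE big_split_ord /=.
by congr (_ + _)%N; apply: eq_bigr => i _; rewrite mnmE.
Qed.

Lemma apply_y_in_xM L F P : apply_y L (in_x F * P) = F * apply_y L P.
Proof.
rewrite (mpolyE P) mulr_sumr !raddf_sum mulr_sumr /=; apply: eq_bigr => m _.
rewrite -scalerAr !apply_yZ -scalerAr; congr (_ *: _).
by rewrite monomial_xy mulrA -in_xM !apply_yM scalerAr.
Qed.

(** All degree bounds on [apply_y] reduce to this value on monomials. *)
Lemma apply_y_in_yM_monomial L F c m :
  apply_y L (in_y F * (c *: 'X_[m])) =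
  (c * L (F * 'X_[ypart m])) *: 'X_[xpart m].
Proof.
by rewrite -scalerAr apply_yZ monomial_xy mulrCA -in_yM apply_yM scalerA.
Qed.

Lemma polys_le_apply_y L F P d :
  polys_le d P -> polys_le d (apply_y L (in_y F * P)).
Proof.
apply: (polys_le_ind (P := fun P => polys_le d (apply_y L (in_y F * P)))).
- by rewrite mulr0 raddf0; apply: polys_le0.
- by move=> p q pd qd; rewrite mulrDr raddfD; apply: polys_leD.
move=> c m md; rewrite apply_y_in_yM_monomial; apply/polys_leZ/polys_leX.
by move: md; rewrite mdeg_xy; lia.
Qed.

(** A monomial x^a y^b of P contributes L.(f_i y^b) x^a.  If |a| >= d - e then
    |b| <= e - deg f_i, so f_i y^b belongs to the annulled set. *)
Lemma polys_le_apply_y_annuls f L i P d e :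
  annuls L (ideal_le f e) -> polys_le (d - mdegree (f i)) P ->
  polys_le (d - e - 1) (apply_y L (in_y (f i) * P)).
Proof.
move=> Lf.
apply: (polys_le_ind
  (P := fun P => polys_le (d - e - 1) (apply_y L (in_y (f i) * P)))).
- by rewrite mulr0 raddf0; apply: polys_le0.
- by move=> p q pd qd; rewrite mulrDr raddfD; apply: polys_leD.
move=> c m; rewrite apply_y_in_yM_monomial mdeg_xy => md.
have [small|large] := lerP (mdeg (xpart m))%:Z (d - e - 1).
  exact/polys_leZ/polys_leX.
rewrite Lf ?mulr0 ?scale0r; first exact: polys_le0.
exists (fun j => if j == i then 'X_[ypart m] else 0); split=> [j|].
  case: eqP => [->|_]; last exact: polys_le0.
  by apply: polys_leX; lia.
rewrite (bigD1 i) //= eqxx big1 ?addr0 // => j /negPf ->.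
by rewrite mulr0.
Qed.

End ApplyY.

(** * The ideal and its degree-bounded parts *)

Section Ideals.
Variables (n : nat) (R : comNzRingType) (f : 'I_n -> {mpoly R[n]}).
Implicit Types (p q : {mpoly R[n]}).

Lemma idealD p q : ideal f p -> ideal f q -> ideal f (p + q).
Proof.
move=> [g ->] [h ->]; exists (fun i => g i + h i).
by rewrite -big_split; apply: eq_bigr => i _; rewrite mulrDr.
Qed.

Lemma idealMl q p : ideal f p -> ideal f (q * p).
Proof.
move=> [g ->]; exists (fun i => q * g i).
by rewrite mulr_sumr; apply: eq_bigr => i _; rewrite mulrCA.
Qed.

Lemma idealN p : ideal f p -> ideal f (- p).
Proof. by rewrite -mulN1r; apply: idealMl. Qed.

Lemma idealB p q : ideal f p -> ideal f q -> ideal f (p - q).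
Proof. by move=> pf qf; apply/idealD/idealN. Qed.

Lemma ideal0 : ideal f 0.
Proof. by exists (fun=> 0); rewrite big1 // => i _; rewrite mulr0. Qed.

Lemma ideal_le_ideal d p : ideal_le f d p -> ideal f p.
Proof. by move=> [g [_ ->]]; exists g. Qed.

Lemma ideal_leW d e p : d <= e -> ideal_le f d p -> ideal_le f e p.
Proof.
move=> de [g [gd ->]]; exists g; split=> // i.
by apply: (polys_leW _ (gd i)); rewrite lerD2r.
Qed.

Lemma ideal_bounded p : ideal f p -> exists k : nat, ideal_le f k p.
Proof.
move=> [g ->].
exists (\sum_i `|(mdegree (f i) + mdegree (g i))%R|)%N; exists g; split=> // i.
apply: (polys_leW _ (@polys_le_mdegree n R (g i))).
by rewrite (bigD1 i) //=; lia.
Qed.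

Lemma ideal_le_lt0 d p :
  (forall i, f i != 0) -> d < 0 -> ideal_le f d p -> p = 0.
Proof.
move=> f0 d0 [g [gd ->]]; rewrite big1 // => i _.
rewrite (polys_le_lt0 _ (gd i)) ?mulr0 //.
by have := mdegree_ge0 (f0 i); lia.
Qed.

Lemma residue_eq p q : ideal f (p - q) -> residue f p = residue f q.
Proof.
move=> pq; apply/seteqP; split=> r /= rp.
  by have := idealD rp pq; rewrite addrA subrK.
by have := idealB rp pq; rewrite opprB addrA subrK.
Qed.

End Ideals.

(** * The extension operation *)

(** The diagonal is left out because 2 may be a zero divisor: a i i = - a i i
    would not give a i i = 0. *)
Lemma sum_alternating (V : zmodType) n (a : 'I_n -> 'I_n -> V) :
  (forall i j, i != j -> a i j = - a j i) -> \sum_i \sum_(j | j != i) a i j = 0.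
Proof.
move=> aN.
have -> : \sum_i \sum_(j | j != i) a i j =
    \sum_(i < n) \sum_(j < n | (j < i)%N) a i j +
    \sum_(i < n) \sum_(j < n | (i < j)%N) a i j.
  rewrite -big_split; apply: eq_bigr => i _ /=.
  rewrite (bigID (fun j : 'I_n => (j < i)%N)) /=.
  congr (_ + _); apply: eq_bigl => j; rewrite -val_eqE /= neq_ltn;
  by case: ltngtP.
rewrite [X in _ + X](exchange_big_dep xpredT) //= -big_split big1 // => i _ /=.
rewrite -big_split big1 // => j ji /=.
by rewrite (aN i j) ?addNr // -val_eqE neq_ltn ji orbT.
Qed.

Section Extension.
Variables (R : comNzRingType) (n : nat) (f : 'I_n -> {mpoly R[n]}).
Notation Rx := {mpoly R[n]}.
Notation Rxy := {mpoly R[(n + n)%N]}.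
Variables (M : 'M[Rxy]_n) (nabla : 'I_n -> {linear Rx -> Rxy}).
Hypothesis (MP : forall i, is_nabla (f i) (col i M)).
Hypothesis (nablaP : forall F, is_nabla F (\col_k nabla k F)).
Implicit Types (F G : Rx) (d e N : int) (v w : 'cV[Rxy]_n).

Let fx : 'rV[Rxy]_n := \row_i in_x (f i).
Let fy : 'rV[Rxy]_n := \row_i in_y (f i).
Let dv F : 'cV[Rxy]_n := \col_k nabla k F.

Lemma polys_le_in_x d F : polys_le d F -> polys_le d (in_x F).
Proof.
by apply: polys_le_comp => i; rewrite tnth_mktuple; apply: polys_leU.
Qed.

Lemma polys_le_in_y d F : polys_le d F -> polys_le d (in_y F).
Proof.
by apply: polys_le_comp => i; rewrite tnth_mktuple; apply: polys_leU.
Qed.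

Lemma polys_le_M k i : polys_le (mdegree (f i) - 1) (M k i).
Proof. by have [/(_ k)] := MP i; rewrite mxE. Qed.

(** When F = 0 and d < -1, the bound does not follow from that of [is_nabla],
    because [mdegree 0] is -1, but from the linearity of the operator. *)
Lemma polys_le_nabla d k F : polys_le d F -> polys_le (d - 1) (nabla k F).
Proof.
have [->|F0] := eqVneq F 0; first by rewrite linear0 => _; apply: polys_le0.
move=> /(mdegree_le F0) Fd; have [/(_ k)] := nablaP F; rewrite mxE => H _.
by apply: (polys_leW _ H); rewrite lerB.
Qed.

Lemma delta_split i :
  \sum_(j | j != i) (mdegree (f j) - 1) = delta f - (mdegree (f i) - 1).
Proof. by rewrite /delta [X in _ = X - _](bigD1 i) //= addrAC subrr add0r. Qed.

Lemma polys_le_detM : polys_le (delta f) (\det M).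
Proof. by apply: polys_le_det => k i; apply: polys_le_M. Qed.

Lemma polys_le_adjM e v i : (forall k, polys_le (e - 1) (v k 0)) ->
  polys_le (delta f - mdegree (f i) + e) ((\adj M *m v) i 0).
Proof.
move=> ve; rewrite mul_adj_colE.
pose d j := if j == i then e - 1 else mdegree (f j) - 1.
suff -> : delta f - mdegree (f i) + e = \sum_j d j.
  apply: polys_le_det => k j; rewrite mxE /d.
  by case: eqP => // _; apply: polys_le_M.
rewrite (bigD1 i) //= /d eqxx (eq_bigr (fun j => mdegree (f j) - 1)).
  by rewrite delta_split; lia.
by move=> j /negPf ->.
Qed.

Lemma polys_le_repl_col2 i j v w : i != j ->
  (forall k, polys_le 0 (v k 0)) -> (forall k, polys_le 0 (w k 0)) ->
  polys_le (delta f - (mdegree (f i) - 1) - (mdegree (f j) - 1))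
    (\det (repl_col (repl_col M i v) j w)).
Proof.
move=> ij v0 w0.
pose d k := if k == j then 0 else if k == i then 0 else mdegree (f k) - 1.
rewrite (_ : _ - _ - _ = \sum_k d k).
  apply: polys_le_det => k l; rewrite mxE /d; case: eqP => // _.
  by rewrite mxE; case: eqP => // _; apply: polys_le_M.
rewrite (bigD1 i) //= (bigD1 j) 1?eq_sym //= /d !eqxx (negPf ij).
have := delta_split i; rewrite (bigD1 j) 1?eq_sym //= => <-.
rewrite [in RHS](eq_bigr (fun k => mdegree (f k) - 1)).
  by rewrite !add0r addrAC subrr add0r.
by move=> k /andP[/negPf -> /negPf ->].
Qed.

Lemma fxE : fx = fy + xBy R n *m M.
Proof.
apply/rowP => i; rewrite !mxE; have [_ /eqP] := MP i.
rewrite subr_eq addrC => /eqP ->; congr (_ + _).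
by apply: eq_bigr => k _; rewrite !mxE.
Qed.

Lemma xBy_nabla F : (xBy R n *m dv F) 0 0 = in_x F - in_y F.
Proof.
by rewrite mxE; have [_ ->] := nablaP F; apply: eq_bigr => k _; rewrite !mxE.
Qed.

Lemma extend_det_in_x F :
  extend_det (@in_x n R) f M F (dv F) =
  in_x F * \det M - (fx *m (\adj M *m dv F)) 0 0.
Proof. exact: det_border. Qed.

Lemma extend_det_in_y F :
  extend_det (@in_x n R) f M F (dv F) =
  in_y F * \det M - (fy *m (\adj M *m dv F)) 0 0.
Proof. by rewrite extend_detE //; apply: det_border. Qed.

(** On a Koszul syzygy, [repl_col_cross] with u = x - y writes the i-th entry of
    adj(M) w as sum_(j != i) (f_j(x) - f_j(y)) D_ij, where D_ij is the
    determinant of M with the columns i and j replaced by two unit vectors.  As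
    D_ij is alternating, the products f_i(x) f_j(x) D_ij cancel out. *)
Lemma adjM_syzygy N w :
  (forall k, polys_le (N - 1) (w k 0)) -> xBy R n *m w = 0 ->
  exists c : 'I_n -> 'I_n -> Rxy,
    (forall i j,
      polys_le (delta f + N - mdegree (f i) - mdegree (f j)) (c i j)) /\
    (fx *m (\adj M *m w)) 0 0 = \sum_i in_x (f i) * \sum_j in_y (f j) * c i j.
Proof.
(* The claim for w is additive in w, so it suffices to treat Koszul syzygies. *)
pose Q w := exists c : 'I_n -> 'I_n -> Rxy,
    (forall i j,
      polys_le (delta f + N - mdegree (f i) - mdegree (f j)) (c i j)) /\
    (fx *m (\adj M *m w)) 0 0 = \sum_i in_x (f i) * \sum_j in_y (f j) * c i j.
move=> wN; apply: (koszul_ind (Q := Q)) wN => {w}.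
- exists (fun _ _ => 0); split=> [i j|]; first exact: polys_le0.
  rewrite !mulmx0 mxE big1 // => i _.
  by rewrite big1 ?mulr0 // => j _; rewrite mulr0.
- move=> v w [a [ad vE]] [b [bd wE]]; exists (fun i j => a i j + b i j).
  split=> [i j|]; first exact: polys_leD.
  rewrite !mulmxDr mxE vE wE -big_split; apply: eq_bigr => i _ /=.
  rewrite -mulrDr -big_split; congr (_ * _).
  by apply: eq_bigr => j _; rewrite mulrDr.
move=> a k l aN; pose e_ (k : 'I_n) : 'cV[Rxy]_n := delta_mx k 0.
have e0 k' k'' : polys_le 0 (e_ k' k'' 0).
  rewrite mxE eqxx andbT.
  by case: eqP => _; [apply: polys_le1 | apply: polys_le0].
pose D i j := \det (repl_col (repl_col M i (e_ l)) j (e_ k)).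
exists (fun i j => if j != i then - (a * D i j) else 0); split=> [i j|].
  case: eqP => [_|/eqP ji]; first exact: polys_le0.
  have ij : i != j by rewrite eq_sym.
  have Dij := polys_le_repl_col2 ij (e0 l) (e0 k).
  by apply/polys_leN/(polys_leW _ (polys_leM aN Dij)); lia.
pose phi := fx - fy.
have phiE : phi = xBy R n *m M by rewrite /phi fxE addrAC subrr add0r.
have ue k' : (xBy R n *m e_ k') 0 0 = xBy R n 0 k' by rewrite -colE mxE.
have adjE i : (\adj M *m (a *: koszul R k l)) i 0 =
    a * \sum_(j | j != i) phi 0 j * D i j.
  rewrite phiE -repl_col_cross !ue -!mul_adj_colE -scalemxAr mxE; congr (_ * _).
  rewrite mulmxBr -!scalemxAr mxE [X in _ + X = _]mxE.
  by rewrite [X in X - _ = _]mxE [X in _ - X = _]mxE.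
have alt : \sum_i \sum_(j | j != i) a * (fx 0 i * fx 0 j * D i j) = 0.
  apply: sum_alternating => i j ij; rewrite /D repl_col_swap // mulrN mulrN.
  by rewrite [fx 0 j * _]mulrC.
have rearrange (b x y z t : Rxy) :
    x * (b * ((y - z) * t)) - b * (x * y * t) = x * (z * - (b * t)) by ring.
rewrite mxE -[LHS]subr0 -[X in _ - X]alt -sumrB; apply: eq_bigr => i _.
rewrite adjE.
rewrite [RHS](_ : _ = fx 0 i * \sum_(j | j != i) in_y (f j) * - (a * D i j)).
  rewrite !mulr_sumr -sumrB; apply: eq_bigr => j _.
  have -> : phi 0 j = fx 0 j - in_y (f j) by rewrite !mxE.
  exact: rearrange.
rewrite [fx _ _]mxE [in RHS]big_mkcond; congr (_ * _).
by apply: eq_bigr => j _; case: ifP; rewrite ?mulr0.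
Qed.

Section Functional.
Variable E : {scalar Rx}.
Let T := extend f M nabla E.

Lemma extendE F : T F = F * apply_y E (\det M) -
  \sum_i f i * apply_y E ((\adj M *m dv F) i 0).
Proof.
rewrite /T /extend extend_det_in_x raddfB /= apply_y_in_xM; congr (_ - _).
rewrite mxE raddf_sum; apply: eq_bigr => i _.
by rewrite [fx _ _]mxE /= apply_y_in_xM.
Qed.

Lemma extendD F G : T (F + G) = T F + T G.
Proof.
have dvD : dv (F + G) = dv F + dv G by apply/colP => k; rewrite !mxE linearD.
rewrite !extendE dvD mulrDl addrACA -opprD; congr (_ - _).
rewrite -big_split; apply: eq_bigr => i _.
by rewrite /= mulmxDr mxE raddfD mulrDr.
Qed.

(** Modulo the ideal, [extendE] says that T F = F b and T 1 = b, where b is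
    E'(y).det M, and T 1 = 1 by hypothesis. *)
Lemma extend_sub_ideal F : ideal f (T 1 - 1) -> ideal f (F - T F).
Proof.
have gen G : ideal f (\sum_i f i * apply_y E ((\adj M *m dv G) i 0)).
  by exists (fun i => apply_y E ((\adj M *m dv G) i 0)).
move=> T1.
rewrite (_ : F - T F = (\sum_i f i * apply_y E ((\adj M *m dv F) i 0))
  - F * (T 1 - 1 + \sum_i f i * apply_y E ((\adj M *m dv 1) i 0))).
  exact: (idealB (gen F) (idealMl F (idealD T1 (gen 1)))).
have rearrange (B a b : Rx) : F - (F * B - a) = a - F * (B - b - 1 + b) by ring.
by rewrite !extendE mul1r; apply: rearrange.
Qed.

Hypothesis Ef : annuls E (ideal_le f (delta f)).

(** In the expression with f(y), the term F(y) det M has degree at most delta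
    in x, and [polys_le_apply_y_annuls] leaves degree at most e - 1 in the
    others. *)
Lemma extend_degree e F : polys_le e F ->
  polys_le (Order.max (delta f) (e - 1)) (T F).
Proof.
move=> Fe; rewrite /T /extend extend_det_in_y raddfB /=; apply: polys_leB.
  apply: (@polys_leW _ _ (delta f)); first by rewrite le_max lexx.
  exact/polys_le_apply_y/polys_le_detM.
apply: (@polys_leW _ _ (delta f + e - delta f - 1)).
  by rewrite le_max; lia.
rewrite mxE [X in polys_le _ X]raddf_sum; apply: polys_le_sum => i _ /=.
rewrite [fy _ _]mxE.
apply: (polys_le_apply_y_annuls Ef).
rewrite addrAC; apply: polys_le_adjM => k.
by rewrite mxE; apply: polys_le_nabla.
Qed.

(** The coefficient of f_j(x) in the determinant is - sum_i f_i(y) h_ij, where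
    h_ij collects the entry of adj(M) nabla g_j and the coefficient c_ji of
    [adjM_syzygy].  Since deg h_ij <= delta + N - deg f_j - deg f_i, applying
    E'(y) leaves degree at most N - 1 - deg f_j. *)
Lemma extend_ideal_le N G : ideal_le f N G -> ideal_le f (N - 1) (T G).
Proof.
move=> [g [gd GE]].
pose gx : 'rV[Rxy]_n := \row_i in_x (g i).
pose gy : 'rV[Rxy]_n := \row_i in_y (g i).
pose V : 'M[Rxy]_n := \matrix_(k, j) nabla k (g j).
have uV : xBy R n *m V = gx - gy.
  apply/rowP => j; have := xBy_nabla (g j); rewrite !mxE => <-.
  by apply: eq_bigr => k _; rewrite !mxE.
pose w := dv G - M *m gy^T - V *m fx^T.
have dot (a b : 'rV[Rxy]_n) : (a *m b^T) 0 0 = \sum_i a 0 i * b 0 i.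
  by rewrite mxE; apply: eq_bigr => i _; rewrite mxE.
have GxE : in_x G = (fx *m gx^T) 0 0.
  by rewrite GE in_x_sum dot; apply: eq_bigr => i _; rewrite in_xM !mxE.
have GyE : in_y G = (fy *m gy^T) 0 0.
  by rewrite GE in_y_sum dot; apply: eq_bigr => i _; rewrite in_yM !mxE.
have uv : (xBy R n *m dv G) 0 0 = (fx *m gx^T) 0 0 - (fy *m gy^T) 0 0.
  by rewrite xBy_nabla GxE GyE.
have uw : xBy R n *m w = 0 by apply: product_rule_syzygy fxE uV uv.
have entry3 (A B C : 'cV[Rxy]_n) k : (A - B - C) k 0 = A k 0 - B k 0 - C k 0.
  by rewrite !mxE.
have wN k : polys_le (N - 1) (w k 0).
  rewrite [w k 0]entry3.
  apply: polys_leB; first apply: polys_leB.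
  - rewrite mxE; apply: polys_le_nabla; rewrite GE; apply: polys_le_sum => i _.
    have fid := @polys_le_mdegree n R (f i).
    by apply: (polys_leW _ (polys_leM fid (gd i))); lia.
  - rewrite mxE; apply: polys_le_sum => i _; rewrite !mxE.
    apply: (@polys_leW _ _ (mdegree (f i) - 1 + (N - mdegree (f i)))).
      by lia.
    by apply: polys_leM; [apply: polys_le_M | apply: polys_le_in_y].
  rewrite mxE; apply: polys_le_sum => i _; rewrite !mxE.
  apply: (@polys_leW _ _ (N - mdegree (f i) - 1 + mdegree (f i))); first by lia.
  apply: polys_leM; first exact: polys_le_nabla.
  exact/polys_le_in_x/polys_le_mdegree.
have [c [cd wE]] := adjM_syzygy wN uw.
(* The indices of c are swapped: its first one goes with the factor f(x). *)
pose h i j := (\adj M *m V) i j + c j i.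
have hd i j : polys_le (delta f + N - mdegree (f j) - mdegree (f i)) (h i j).
  apply: polys_leD => //.
  have -> : (\adj M *m V) i j = (\adj M *m col j V) i 0.
    by rewrite colE mulmxA -colE [RHS]mxE.
  rewrite (_ : _ - _ - _ = delta f - mdegree (f i) + (N - mdegree (f j))).
    by apply: polys_le_adjM => k; rewrite !mxE; apply: polys_le_nabla.
  by ring.
exists (fun j => - apply_y E (\sum_i in_y (f i) * h i j)); split=> [j|].
  apply: polys_leN; rewrite [X in polys_le _ X]raddf_sum.
  apply: polys_le_sum => i _ /=.
  rewrite (_ : _ - _ = delta f + N - mdegree (f j) - delta f - 1); last by ring.
  exact: (polys_le_apply_y_annuls Ef).
suff -> : T G = - apply_y E (\sum_j in_x (f j) * \sum_i in_y (f i) * h i j).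
  rewrite [X in - X = _]raddf_sum -sumrN; apply: eq_bigr => j _ /=.
  by rewrite apply_y_in_xM mulrN.
rewrite /T /extend extend_det_in_x -raddfN /=; congr (apply_y E _).
have VE : (fy *m (\adj M *m (V *m fx^T))) 0 0 =
    \sum_j in_x (f j) * \sum_i in_y (f i) * (\adj M *m V) i j.
  rewrite [\adj M *m _]mulmxA mulmxA dot; apply: eq_bigr => j _.
  rewrite [fx _ _]mxE mulrC [(fy *m _) _ _]mxE; congr (_ * _).
  by apply: eq_bigr => i _; rewrite [fy _ _]mxE.
rewrite GxE (product_rule_det (dv G) fxE uV); congr (- _).
rewrite VE wE -big_split; apply: eq_bigr => j _ /=.
rewrite -mulrDr -big_split; congr (_ * _); apply: eq_bigr => i _ /=.
by rewrite -mulrDr.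
Qed.

End Functional.
End Extension.

Theorem theorem7 (R : comNzRingType) (n : nat) (f : 'I_n -> {mpoly R[n]})
  (f_neq0 : forall i, f i != 0)
  (nabla_f : 'M[{mpoly R[(n + n)%N]}]_n)
  (nabla_fP : forall i, is_nabla (f i) (col i nabla_f))
  (nabla : 'I_n -> {linear {mpoly R[n]} -> {mpoly R[(n + n)%N]}})
  (nablaP : forall F, is_nabla F (\col_k nabla k F))
  (E' : {scalar {mpoly R[n]}})
  (E'_annuls : annuls E' (ideal f) \/
    exists eps : int, 0 <= eps /\ annuls E' (ideal_le f (delta f + eps)))
  (E'_unit : ideal f (extend f nabla_f nabla E' 1 - 1)) :
  (range (residue f) =
     [set residue f (extend f nabla_f nabla E' F) | F in polys_le (delta f)] /\
   (forall F, polys_le (delta f) F ->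
     polys_le (delta f) (extend f nabla_f nabla E' F))) /\
  (forall d' : int, delta f <= d' ->
     ideal f `&` polys_le d' =
     [set F - extend f nabla_f nabla E' F | F in polys_le d']).
Proof.
have Ef : annuls E' (ideal_le f (delta f)).
  case: E'_annuls => [Eideal s /ideal_le_ideal|[eps [eps_ge0 Ele]] s].
    exact: Eideal.
  by move=> sf; apply/Ele/(ideal_leW _ sf); rewrite lerDl.
set T := extend f nabla_f nabla E'.
have T_mod F : ideal f (F - T F) by apply: extend_sub_ideal.
have T_drop e F : polys_le e F -> polys_le (Order.max (delta f) (e - 1)) (T F).
  exact: (extend_degree nabla_fP nablaP Ef).
have T_degree e F : delta f <= e -> polys_le e F -> polys_le e (T F).
  move=> le_e /T_drop; apply: polys_leW; rewrite ge_max le_e /=; lia.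
split; first split.
- apply/seteqP; split=> _ [F _ <-] /=; last by exists (T F).
  suff [F' F'd FF'] : exists2 F', polys_le (delta f) F' & ideal f (F' - F).
    exists F' => //; apply: residue_eq.
    by have := idealB FF' (T_mod F'); rewrite opprB addrC addrA subrK.
  have [k Fk] : exists k : nat, polys_le (delta f + k%:Z) F.
    exists `|mdegree F - delta f|%N.
    by apply: (polys_leW _ (@polys_le_mdegree n R F)); lia.
  (* Each application of T lowers a degree above delta. *)
  elim: k F Fk => [|k IH] F Fk.
    by exists F; rewrite ?subrr; [rewrite addr0 in Fk | apply: ideal0].
  have [|F' F'd F'T] := IH (T F).
    by apply: (polys_leW _ (T_drop _ _ Fk)); rewrite ge_max; lia.
  exists F' => //; have := idealB F'T (T_mod F).
  by rewrite opprB addrA subrK.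
- by move=> F; apply: T_degree.
move=> d' le_d'; apply/seteqP; split=> [G [Gf Gd]|_ [F Fd <-]] /=; last first.
  by split; [apply: T_mod | apply: polys_leB => //; apply: T_degree].
have [k Gk] := ideal_bounded Gf.
have {Gk} Gk : ideal_le f (k.+1%:Z - 1) G by apply: (ideal_leW _ Gk); lia.
(* T is nilpotent on the ideal: the solution for G is G plus that for T G. *)
elim: k.+1 G Gk Gd {Gf} => [|{}k IH] G Gk Gd.
  have TG := extend_ideal_le nabla_fP nablaP Ef Gk.
  have TG0 : T G = 0 by apply: (ideal_le_lt0 f_neq0 _ TG).
  by exists G; rewrite // TG0 subr0.
have [||F Fd FE] := IH (T G).
- apply: (extend_ideal_le nabla_fP nablaP Ef).
  by apply: (ideal_leW _ Gk); lia.
- exact: T_degree.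
exists (G + F); first exact: polys_leD.
rewrite /T extendD -/T.
by rewrite opprD addrACA FE subrK.
Qed.
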